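(* Let $G$ be an OTG with $n\geq 5$ vertices, let $X$ be a minimum $H$-force set of $G$, and let $C_w(G)$ be the weak closure of $G$. Then (1) $h(G)\in\{n-2,\ \tfrac{n}{2},\ n\}$; and (2) if $h(G)=n-2$ then $X=V(G)\setminus\{x,y\}$, where $x,y\in V(G)$ are vertices with $d_{C_w(G)}(x)=d_{C_w(G)}(y)=n-1$; if $h(G)=\tfrac{n}{2}$ then $X=S$, where $S$ is a largest independent set of $C_w(G)$; and if $h(G)=n$ then $X=V(G)$.
   Context: All graphs are finite and simple. A graph $G$ with $n$ vertices is called an OTG if $d(u)+d(v)\geq n$ for every pair of distinct nonadjacent vertices $u,v$ of $G$ (such a graph with $n\ge3$ is Hamiltonian by Ore's theorem). For $X\subseteq V(G)$, an $X$-cycle is a cycle of $G$ containing all vertices of $X$. For a Hamiltonian graph $G$, a nonempty $X\subseteq V(G)$ is an $H$-force set if every $X$-cycle of $G$ is Hamiltonian; $h(G)$ is the smallest cardinality of an $H$-force set; a minimum $H$-force set is an $H$-force set of cardinality $h(G)$. The weak closure $C_w(G)$ of an OTG $G$ on $n$ vertices is the graph obtained from $G$ by repeatedly joining a pair of nonadjacent vertices whose degree sum (in the current graph) is at least $n+1$, until no such pair remains; it is well defined (independent of the order of additions). A largest independent set is an independent set of maximum cardinality. *)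

(* Defs.v *)
From mathcomp Require Import all_boot.
Set Implicit Arguments.
Unset Strict Implicit.
Unset Printing Implicit Defensive.

(* A graph is a symmetric irreflexive relation [e] on a finite type [T]. *)

Definition deg (T : finType) (e : rel T) (v : T) : nat := #|[set w | e v w]|.

Definition OTG (T : finType) (e : rel T) : Prop :=
  forall u v : T, u != v -> ~~ e u v -> #|T| <= deg e u + deg e v.

(* [size c > 2] excludes the degenerate closed walks [::], [:: x] and
   [:: x; y], which [cycle e] accepts. *)
Definition is_cycle (T : finType) (e : rel T) (c : seq T) : bool :=
  [&& 2 < size c, cycle e c & uniq c].

Definition X_cycle (T : finType) (e : rel T) (X : {set T}) (c : seq T) : bool :=
  is_cycle e c && (X \subset c).

Definition hamiltonian_cycle (T : finType) (e : rel T) (c : seq T) : bool :=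
  is_cycle e c && [forall v, v \in c].

(* A cycle has at most #|T| vertices, so ranging over tuples of bounded length
   loses nothing (see [H_forceP]) and makes the property decidable. *)
Definition H_force (T : finType) (e : rel T) (X : {set T}) : bool :=
  (X != set0) &&
  [forall k : 'I_#|T|.+1, forall c : k.-tuple T,
     X_cycle e X c ==> hamiltonian_cycle e c].

Lemma H_forceP (T : finType) (e : rel T) (X : {set T}) :
  reflect (X != set0 /\
           forall c : seq T, X_cycle e X c -> hamiltonian_cycle e c)
          (H_force e X).
Proof.
apply: (iffP andP) => -[X0 H]; split=> //.
  move=> c Xc.
  have /and3P[_ _ uc] : is_cycle e c by case/andP: Xc.
  have sc : size c < #|T|.+1 by rewrite ltnS -(card_uniqP uc) max_card.
  move/forallP/(_ (Ordinal sc))/forallP/(_ (in_tuple c))/implyP: H.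
  exact.
by apply/forallP=> k; apply/forallP=> c; apply/implyP; apply: H.
Qed.

(* [setT] is an H-force set as soon as [T] is nonempty ([H_force_setT]), so this
   is the smallest cardinality of an H-force set ([h_leq], [h_attained]). *)
Definition h (T : finType) (e : rel T) : nat :=
  #|[arg min_(X < [set: T] | H_force e X) #|X|]|.

Lemma H_force_setT (T : finType) (e : rel T) :
  0 < #|T| -> H_force e [set: T].
Proof.
move=> T0; apply/H_forceP; split; first by rewrite -card_gt0 cardsT.
move=> c /andP[cc /subsetP Tc]; apply/andP; split=> //.
by apply/forallP=> v; apply: Tc; rewrite inE.
Qed.

Lemma h_leq (T : finType) (e : rel T) (X : {set T}) :
  0 < #|T| -> H_force e X -> h e <= #|X|.
Proof.
by move=> T0 HX; rewrite /h; case: arg_minnP => [|Y _]; [apply: H_force_setT|apply].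
Qed.

Lemma h_attained (T : finType) (e : rel T) :
  0 < #|T| -> exists2 X : {set T}, H_force e X & #|X| = h e.
Proof.
move=> T0; rewrite /h; case: arg_minnP => [|X HX _]; first exact: H_force_setT.
by exists X.
Qed.

Definition min_H_force (T : finType) (e : rel T) (X : {set T}) : bool :=
  H_force e X && (#|X| == h e).

Definition add_edge (T : finType) (e : rel T) (u v : T) : rel T :=
  fun x y => [|| e x y, (x == u) && (y == v) | (x == v) && (y == u)].

Definition joinable (T : finType) (e : rel T) (u v : T) : bool :=
  [&& u != v, ~~ e u v & #|T|.+1 <= deg e u + deg e v].

(* The degree condition is tested in the current graph [f]. *)
Inductive weak_joins (T : finType) (e : rel T) : rel T -> Prop :=
| weak_joins_refl : weak_joins e e
| weak_joins_step (f : rel T) (u v : T) :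
    weak_joins e f -> joinable f u v -> weak_joins e (add_edge f u v).

(* [c] is a possible outcome of the joining process started from [e]; such a [c]
   exists and is unique as a relation ([weak_closure_exists],
   [weak_closure_unique]). *)
Definition weak_closure (T : finType) (e c : rel T) : Prop :=
  weak_joins e c /\ forall u v : T, ~~ joinable c u v.

Lemma weak_closure_exists (T : finType) (e : rel T) :
  exists c : rel T, weak_closure e c.
Proof.
pose m (f : rel T) := #|[set p : T * T | ~~ f p.1 p.2]|.
suff H k f : m f < k -> weak_joins e f -> exists c, weak_closure e c.
  exact: (H (m e).+1 e (ltnSn _) (weak_joins_refl e)).
elim: k f => // k IH f mk ef.
case: (boolP [exists p : T * T, joinable f p.1 p.2]); last first.
  move/existsPn=> H; exists f; split=> // u v; exact: (H (u, v)).
case/existsP=> -[u v] /= j; apply: IH (weak_joins_step ef j).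
apply: leq_trans (_ : m f <= k) => //; apply: proper_card; apply/properP; split.
  by apply/subsetP=> -[x y]; rewrite !inE /add_edge negb_or => /andP[].
exists (u, v); rewrite !inE /=; first by case/and3P: j.
by rewrite /add_edge !eqxx orbT.
Qed.

Lemma weak_closure_unique (T : finType) (e c d : rel T) :
  symmetric e -> weak_closure e c -> weak_closure e d -> c =2 d.
Proof.
move=> se.
have sub f : weak_joins e f -> symmetric f /\ subrel e f.
  elim=> [|g u v _ [sg eg] _]; first by split.
  split=> [x y|x y /eg gxy]; last by rewrite /add_edge gxy.
  by rewrite /add_edge sg; congr (_ || _); rewrite orbC andbC [X in _ || X]andbC.
have le f g : weak_joins e f -> weak_closure e g -> subrel f g.
  move=> + [/sub[sg eg] tg]; elim=> // k u v _ kg /and3P[uv _ d_uv].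
  have gm z : deg k z <= deg g z.
    by apply/subset_leq_card/subsetP=> x; rewrite !inE; apply: kg.
  have guv : g u v.
    have := tg u v; rewrite /joinable uv /=.
    by rewrite (leq_trans d_uv (leq_add (gm u) (gm v))) andbT negbK.
  move=> x y /or3P[/kg//|/andP[/eqP-> /eqP->]//|/andP[/eqP-> /eqP->]].
  by rewrite sg.
move=> ec ed x y; apply/idP/idP; [apply: le ed _ _|apply: le ec _ _].
  by case: ec.
by case: ed.
Qed.

Definition independent (T : finType) (e : rel T) (S : {set T}) : bool :=
  [forall u in S, forall v in S, ~~ e u v].

Definition largest_independent (T : finType) (e : rel T) (S : {set T}) : Prop :=
  independent e S /\ forall R : {set T}, independent e R -> #|R| <= #|S|.

(* Main.v *)
(* If a vertex v lies outside an H-force set, then G - v is not Hamiltonian.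
   Write n for the order of G; G - v has order m = n - 1, and nonadjacent
   vertices of G - v still have degree sum at least m - 1 there.  Enlarge G - v
   to a maximal non-Hamiltonian graph.  There every nonadjacent pair x, y is
   joined by a Hamiltonian path, has degree sum exactly m - 1, and every vertex a
   other than y on that path satisfies exactly one of "x is adjacent to the
   successor of a" and "y is adjacent to a".  If the neighbours of x form an
   initial segment of the path, the last of them is a cut vertex w.  Otherwise
   some vertex u is missed by a cycle through all the other vertices, and u
   together with the successors of its neighbours on that cycle is independent,
   of size n / 2.
   Back in G the degree condition is then tight: either v and w are joined to
   everything else, which splits into two cliques without edges between them, or
   there is an independent set of size n / 2 completely joined to its complement.
   In the first case only v and w can be left out of an H-force set; in the
   second the independent set is itself an H-force set. *)
Require Import Defs.
From mathcomp Require Import all_boot zify.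

Set Implicit Arguments.
Unset Strict Implicit.
Unset Printing Implicit Defensive.

Ltac nat_lia :=
  repeat match goal with
    | H : ?P |- _ =>
      lazymatch P with
      | is_true (leq _ _) => fail
      | @eq nat _ _ => fail
      | _ => clear H
      end
    end; lia.
Ltac count_lia := do ?move: (nat_of_bool _) => ?; clear; lia.

(** * Cyclic sequences and rerouting *)

Section Sequences.

Variable T : eqType.
Implicit Types (f : rel T) (a x y : T) (s t : seq T).

(** Follow the first path, cross to the end of the second, return along it and close with the edge
    from y to x. Most reroutings below have this form. *)
Lemma cycle_cat_rev f x y s t :
    symmetric f -> path f x s -> path f y t ->
    f (last x s) (last y t) -> f x y ->
  cycle f ((x :: s) ++ rev (y :: t)).
Proof.
move=> f_sym xs yt f_last fxy.
rewrite /= rcons_cat cat_path xs -rev_cons.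
have -> : x :: y :: t = belast x (rcons (y :: t) (last x s)).
  by rewrite belast_rcons.
rewrite -[X in path f X](last_rcons x (y :: t)) rev_path.
rewrite (eq_path (e' := f)); last by move=> z z'; rewrite f_sym.
by rewrite rcons_path /= fxy yt f_sym.
Qed.

(** The nested default is the wrap-around: if [t] is empty, the successor of [a] is the first vertex
    of [s], or [a] itself if [s] is empty too. *)
Lemma next_cat s a t :
  uniq (s ++ a :: t) -> next (s ++ a :: t) a = head (head a s) t.
Proof.
move=> us; rewrite next_nth mem_cat mem_head orbT.
have a_s : a \notin s by move: us; rewrite cat_uniq /= negb_or => /and3P[_ /andP[]].
case: s a_s us => [|z s] a_s us /=; first by rewrite eqxx /= nth0.
move: a_s; rewrite inE negb_or eq_sym => /andP[/negPf-> a_s].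
rewrite index_cat (negPf a_s) /= eqxx addn0.
by case: t us => [|b t] us; rewrite nth_cat /= ltnNge leqnSn /= subSn // subnn.
Qed.

(** With P adjacency to the first vertex of a Hamiltonian path, the first alternative will yield a
    cut vertex and the second a vertex that can be cut out of the path. *)
Lemma prefix_or_switch (P : pred T) s :
  (exists s1 s2, [/\ s = s1 ++ s2, all P s1 & all (predC P) s2]) \/
  (exists s1 u b s2, [/\ s = s1 ++ u :: b :: s2, ~~ P u & P b]).
Proof.
elim: s => [|z s [[s1] [s2] [-> P1 P2]|[s1] [u] [b] [s2] [-> Pu Pb]]].
- by left; exists [::], [::].
- case Pz: (P z); first by left; exists (z :: s1), s2; rewrite /= Pz.
  case: s1 P1 => [|b s1] /= P1; first by left; exists [::], (z :: s2); rewrite /= Pz.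
  by right; exists [::], z, b, (s1 ++ s2); rewrite Pz; case/andP: P1.
- by right; exists (z :: s1), u, b, s2.
Qed.

End Sequences.

(** * Vertex sets without a spanning cycle *)

Section Spanning.

Variable T : finType.
Implicit Types (f e : rel T) (D L R S : {set T}) (x y u v w : T) (c s : seq T).

Definition spanning e D c : bool := is_cycle e c && ([set x in c] == D).

Definition ham_on e D : bool := [exists c : #|D|.-tuple T, spanning e D c].

Lemma ham_onP e D : reflect (exists c, spanning e D c) (ham_on e D).
Proof.
apply: (iffP existsP) => [[c]|[c Dc]]; first by exists c.
suff sc : size c == #|D| by exists (Tuple sc).
by case/andP: Dc => /and3P[_ _ /card_uniqP<-] /eqP<-; rewrite cardsE.
Qed.

Lemma cycle_ham_on f D c s :
    cycle f c -> perm_eq c s -> uniq s -> [set z in s] = D -> 2 < #|D| ->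
  ham_on f D.
Proof.
move=> cc cs us sD D2; apply/ham_onP; exists c; rewrite /spanning /is_cycle cc.
rewrite (perm_uniq cs) us (perm_size cs) -(card_uniqP us).
rewrite -[#|s|]cardsE sD D2 -sD /=.
by apply/eqP/setP => z; rewrite [LHS]inE (perm_mem cs) [RHS]inE.
Qed.

Lemma complete_ham_on f D :
    2 < #|D| -> {in D &, forall x y, x != y -> f x y} -> ham_on f D.
Proof.
move=> D2 Df; apply/ham_onP; exists (enum D); apply/andP; split; last first.
  by apply/eqP/setP => z; rewrite inE mem_enum.
have u : uniq (enum D) := enum_uniq _.
rewrite /is_cycle u -cardE D2 andbT.
apply: cycle_from_next => // x xD; apply: Df.
- by rewrite -mem_enum.
- by rewrite -mem_enum mem_next.
rewrite cardE in D2; case/splitPr: xD u D2 => s t; case: t => [|b t] u.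
  case: s u => [|b s] u // _; rewrite next_cat //.
  by move: u; rewrite cats1 rcons_uniq inE negb_or => /andP[/andP[]].
move=> _; rewrite next_cat //; move: u; rewrite cat_uniq => /and3P[_ _ /andP[]].
by rewrite inE negb_or => /andP[].
Qed.

(** Indexing the neighbours of x by their predecessors lets them be compared, vertex by vertex, with
    the neighbours of the other end of a path. *)
Lemma degin_next f D x s :
    uniq s -> [set z in s] = D ->
  #|[set z in D | f x z]| = #|[set a in D | f x (next s a)]|.
Proof.
move=> us sD.
have i : injective (next s) by apply: can_inj (prev_next us).
rewrite -[RHS](card_imset _ i); congr #|pred_of_set _|.
apply/setP => z; apply/idP/imsetP.
  rewrite !inE => /andP[zD xz]; exists (prev s z); last by rewrite next_prev.
  by move: zD; rewrite inE next_prev // xz -sD !inE mem_prev andbT.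
by case=> a; rewrite inE => /andP[aD xa] ->; move: aD; rewrite inE xa -sD !inE mem_next andbT.
Qed.

Definition hpath f D x y s :=
  [/\ path f x s, last x s = y, uniq (x :: s) & [set z in x :: s] = D].

(** Otherwise, with b the successor of a, the cycle x .. a y .. b x would span D. *)
Lemma hpath_crossing f D x y s a :
    symmetric f -> irreflexive f -> 2 < #|D| -> ~~ ham_on f D ->
    hpath f D x y s -> a \in D ->
  ~~ (f x (next (x :: s) a) && f y a).
Proof.
move=> f_sym f_irr D2 nham [xs lx us sD] aD.
apply/negP => /andP[xa ya]; case/negP: nham.
have {aD} : a \in x :: s by rewrite -sD inE in aD.
move E : (x :: s) => p ap; case/splitPr: ap E => s1 t E.
have ut : uniq (s1 ++ a :: t) by rewrite -E.
rewrite E (next_cat ut) in xa.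
(* If a is the last vertex it is y, and y is not adjacent to itself. *)
case: t => [|b t] in E xa ut *.
  have : last x (x :: s) = a by rewrite E last_cat.
  by rewrite /= lx => ea; rewrite ea f_irr in ya.
have /= E' : x :: s = rcons s1 a ++ b :: t by rewrite cat_rcons.
case E1 : (rcons s1 a) => [|x1 s2]; first by case: (s1) E1.
rewrite E1 in E'; case: E' => ex es; subst x1 s.
move: xs; rewrite cat_path /= => /and3P[xs2 ab bt].
have la : last x s2 = a by rewrite -[LHS]/(last x (x :: s2)) -E1 last_rcons.
apply: (cycle_ham_on (c := (x :: s2) ++ rev (b :: t))) us sD D2; last first.
  by rewrite -cat_cons perm_cat2l perm_rev.
apply: (cycle_cat_rev (s := s2)) => //; rewrite la.
by rewrite last_cat /= in lx; rewrite f_sym lx.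
Qed.

Lemma next_last x s : uniq (x :: s) -> next (x :: s) (last x s) = x.
Proof.
case/lastP: s => [|s y] u; first by rewrite /= eqxx.
by rewrite last_rcons -cats1 -cat_cons next_cat // cat_cons cats1.
Qed.

(** The set A of predecessors of neighbours of x and the set B of neighbours of y are disjoint by
    [hpath_crossing]. Both miss y, whose cyclic successor is x. If their sizes add up to #|D| - 1,
    they fill D minus y. *)
Lemma hpath_degin f D x y s :
    symmetric f -> irreflexive f -> 2 < #|D| -> ~~ ham_on f D ->
    hpath f D x y s ->
  #|[set z in D | f x z]| + #|[set z in D | f y z]| < #|D| /\
  (#|D| <= (#|[set z in D | f x z]| + #|[set z in D | f y z]|).+1 ->
     forall a, a \in D -> a != y -> f x (next (x :: s) a) || f y a).
Proof.
move=> f_sym f_irr D2 nham xs.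
have cross a := @hpath_crossing f D x y s a f_sym f_irr D2 nham xs.
case: xs => _ lx us sD; rewrite (degin_next f x us sD).
set A := [set a in D | _]; set B := [set z in D | _].
have AB : A :&: B = set0.
  apply/setP => a; rewrite !inE andbACA andbb.
  by apply/negP => /andP[/cross/negP].
have yD : y \in D by rewrite -sD inE -lx mem_last.
have AU : A :|: B \subset D :\ y.
  apply/subsetP => a; rewrite !inE -andb_orr => /andP[-> fa]; rewrite andbT.
  by apply: contraL fa => /eqP->; rewrite -{1}lx next_last // !f_irr.
have cU : #|A :|: B| = #|A| + #|B| by rewrite cardsU AB cards0 subn0.
have cD : #|D| = #|D :\ y|.+1 by rewrite (cardsD1 y) yD.
split; first by rewrite -cU cD ltnS subset_leq_card.
rewrite -cU cD ltnS => le a aD ay.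
have /eqP AUE : A :|: B == D :\ y by rewrite eqEcard AU le.
have : a \in D :\ y by rewrite !inE ay aD.
by rewrite -AUE !inE aD.
Qed.

Lemma add_edge_sym f x y : symmetric f -> symmetric (add_edge f x y).
Proof.
by move=> fs a b; rewrite /add_edge fs; congr orb; rewrite orbC andbC [X in _ || X]andbC.
Qed.

Lemma hpath_rev f D x y s :
  symmetric f -> hpath f D x y s -> exists t, hpath f D y x t.
Proof.
move=> f_sym [xs lx us sD]; exists (rev (belast x s)).
have E : y :: rev (belast x s) = rev (x :: s).
  by rewrite -lx -rev_rcons -lastI.
split.
- rewrite -lx rev_path (eq_path (e' := f)) // => z z'; exact: f_sym.
- by case: (s) lx => [|a s'] //= lx; rewrite rev_cons last_rcons.
- by rewrite E rev_uniq.
- by rewrite -sD; apply/setP => z; rewrite [LHS]inE E mem_rev [RHS]inE.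
Qed.

(** The new cycle must use the edge xy; removing that edge leaves the path. *)
Lemma ham_on_add_edge f D x y :
    symmetric f -> ham_on (add_edge f x y) D -> ~~ ham_on f D ->
  exists s, hpath f D x y s.
Proof.
move=> f_sym /ham_onP[c /andP[/and3P[c2 cc uc] /eqP cD]] nham.
have [a ac nfa] : exists2 a, a \in c & ~~ f a (next c a).
  apply/hasP; apply: contraR nham => /hasPn H.
  apply/ham_onP; exists c; rewrite /spanning /is_cycle c2 uc cD eqxx !andbT.
  by apply: cycle_from_next => // a /H; rewrite negbK.
have [i t rc] := rot_to ac.
rewrite -(next_rot i uc) rc in nfa.
rewrite -(rot_cycle i) rc in cc; rewrite -(rot_uniq i) rc in uc.
rewrite -(size_rot i) rc in c2.
have {rc i} cD : [set z in a :: t] = D.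
  by rewrite -cD; apply/setP => z; rewrite [LHS]inE -rc mem_rot [RHS]inE.
case: t => [|b [|d t]] //= in cc uc c2 cD nfa *.
rewrite eqxx in nfa.
case/and3P: cc; rewrite {1}/add_edge (negPf nfa) /= => xy bd dt.
(* Here {a, b} = {x, y}. The step from b goes to d, which is not a, and the later steps avoid b, so
   none of them is the added edge. *)
have {nfa}[t' [p l u D']] : exists t, hpath f D b a t.
  exists (rcons (d :: t) a); split=> //.
  - move: uc; rewrite /= !inE !negb_or => /and4P[/and3P[ab ad at_] /andP[bd' bt] _ _] /=.
    rewrite -[path _ _ _]/(path f d (rcons t a)).
    have -> : f b d.
      move: bd; rewrite /add_edge; case: (f b d) => //=.
      by case/orP: xy => /andP[/eqP ax /eqP bx];
        rewrite -ax -bx !(eq_sym d) (negPf ad) (negPf bd') !andbF.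
    apply: (sub_in_path (P := predC1 b) (e := add_edge f x y)) dt; last first.
      rewrite /= all_rcons /= ab eq_sym bd' /=.
      by apply/allP => z zt; apply: contraNneq bt => <-.
    move=> z z' /= zb zb'; rewrite /add_edge; case: (f z z') => //=.
    by case/orP: xy => /andP[/eqP ax /eqP bx];
      rewrite -ax -bx (negPf zb) (negPf zb') ?andbF.
  - by rewrite last_rcons.
  - by rewrite -rcons_cons rcons_uniq.
  - by rewrite -cD; apply/setP => z; rewrite !inE mem_rcons !inE; do ?case: eqP.
have {}p : hpath f D b a t' by [].
case/orP: xy => /andP[/eqP ax /eqP bx]; rewrite -ax -bx; last by exists t'.
exact: hpath_rev p.
Qed.

Definition separated_on f D :=
  exists w L R, [/\ w \in D, D :\ w = L :|: R, L :&: R = set0,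
    (L != set0) && (R != set0) & {in L & R, forall l r, ~~ f l r}].

(** For D the complement of one vertex, this size is half the order of the whole graph. *)
Definition half_independent_on f D :=
  exists S, [/\ S \subset D, independent f S & #|S|.*2 = #|D|.+1].

(* If u is adjacent to consecutive vertices, it can be inserted between them; if
   the successors b1, b2 of its neighbours a1, a2 are adjacent, the cycle
   u a2 .. b1 b2 .. a1 u is Hamiltonian. *)
Lemma successors_independent f D u c :
    symmetric f -> irreflexive f -> ~~ ham_on f D ->
    2 < size c -> cycle f c -> uniq c -> u \notin c -> [set z in u :: c] = D ->
  independent f (u |: next c @: [set a in D | f u a]).
Proof.
move=> f_sym f_irr nham c2 cc uc uNc cD.
have mem_nbr a : a \in D -> f u a -> a \in c.
  rewrite -cD !inE => /orP[/eqP->|//]; by rewrite f_irr.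
have ham p : cycle f p -> perm_eq p (u :: c) -> False.
  move=> cp pc; case/negP: nham; apply: (cycle_ham_on cp pc _ cD).
    by rewrite /= uNc.
  by rewrite -cD cardsE (card_uniqP _) /= ?uNc // ltnS ltnW.
have u_next a : a \in D -> f u a -> ~~ f u (next c a).
  move=> aD ua; apply/negP => ub.
  have [i t rc] := rot_to (mem_nbr a aD ua).
  rewrite -(next_rot i uc) rc in ub.
  rewrite -(rot_cycle i) rc in cc.
  rewrite -(size_rot i) rc in c2.
  case: t => [|b t] // in rc cc c2 ub *; rewrite /= eqxx in ub.
  apply: (ham (u :: rcons (b :: t) a)).
    move: cc; rewrite /= => /andP[_]; rewrite !rcons_path ub last_rcons => -> /=.
    by rewrite f_sym.
  by rewrite perm_cons perm_rcons -rc perm_rot.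
have next_next a1 a2 : a1 \in D -> a2 \in D -> f u a1 -> f u a2 ->
    ~~ f (next c a1) (next c a2).
  move=> a1D a2D ua1 ua2; apply/negP => b12.
  have [a12|a12] := eqVneq a1 a2; first by rewrite a12 f_irr in b12.
  have [i t rc] := rot_to (mem_nbr a1 a1D ua1).
  have : a2 \in a1 :: t by rewrite -rc mem_rot mem_nbr.
  rewrite inE eq_sym (negPf a12) /= => a2t.
  have uc' : uniq (a1 :: t) by rewrite -rc rot_uniq.
  rewrite -!(next_rot i uc) rc in b12.
  have pc : perm_eq (a1 :: t) c by rewrite -rc perm_rot.
  rewrite -(rot_cycle i) rc in cc.
  case/splitPr: a2t => t1 t2 in uc' b12 pc cc *.
  have e1 : next (a1 :: t1 ++ a2 :: t2) a1 = head a2 t1.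
    by rewrite (next_cat (s := [::]) uc'); case: (t1).
  have e2 : next (a1 :: t1 ++ a2 :: t2) a2 = head a1 t2.
    by rewrite (next_cat (s := a1 :: t1) uc').
  rewrite e1 e2 in b12.
  have E1 : rcons t1 a2 = head a2 t1 :: behead (rcons t1 a2) by case: (t1).
  have E2 : rcons t2 a1 = head a1 t2 :: behead (rcons t2 a1) by case: (t2).
  apply: (ham (rcons (rcons t2 a1) u ++ rev (rcons t1 a2))).
    rewrite E1 {1}E2 rcons_cons.
    have : path f a1 (rcons t1 a2 ++ rcons t2 a1) by rewrite -rcons_cat cat_rcons.
    rewrite cat_path last_rcons {1}E1 {1}E2 => /= /andP[/andP[_ p1] /andP[_ p2]].
    have l1 : last (head a2 t1) (behead (rcons t1 a2)) = a2.
      by rewrite -[LHS]/(last a2 (_ :: _)) -E1 last_rcons.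
    have l2 : last (head a1 t2) (behead (rcons t2 a1)) = a1.
      by rewrite -[LHS]/(last a1 (_ :: _)) -E2 last_rcons.
    apply: cycle_cat_rev => //.
    - by rewrite rcons_path p2 l2 f_sym.
    - by rewrite last_rcons l1.
    - by rewrite f_sym.
  rewrite -[u :: c]cat1s perm_sym perm_catC perm_sym.
  apply: perm_trans (_ : perm_eq _ ((a1 :: t1 ++ a2 :: t2) ++ [:: u])) _; last first.
    by rewrite perm_cat2r.
  by apply/permP => P; rewrite -!cats1 !(count_cat, count_rev) /= !count_cat /=; count_lia.
apply/forall_inP => z zS; apply/forall_inP => z' zS'.
case/setU1P: zS zS' => [->|/imsetP[a + ->]] /setU1P[->|/imsetP[a' + ->]].
- by rewrite f_irr.
- by rewrite inE => /andP[]; apply: u_next.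
- by rewrite f_sym inE => /andP[]; apply: u_next.
- by rewrite !inE => /andP[a'D ua'] /andP[aD ua]; apply: next_next.
Qed.

(** Tight degree sums make the crossing condition of [hpath_degin] an alternative at every vertex a
    other than y: where x misses the successor of a, y is adjacent to a. The assumption that x has
    at most the degree of y later gives u at least two neighbours. *)
Lemma hpath_structure f D x y s :
    symmetric f -> irreflexive f -> 3 < #|D| -> ~~ ham_on f D ->
    {in D &, forall a b, a != b -> ~~ f a b ->
       (#|[set z in D | f a z]| + #|[set z in D | f b z]|).+1 = #|D|} ->
    x != y -> ~~ f x y ->
    #|[set z in D | f x z]| <= #|[set z in D | f y z]| ->
    hpath f D x y s ->
  separated_on f D \/ half_independent_on f D.
Proof.
move=> f_sym f_irr D4 nham sum_eq xy nxy le ps.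
have [xs lx us sD] := ps.
have mem_D z : (z \in D) = (z \in x :: s) by rewrite -sD inE.
have xD : x \in D by rewrite mem_D mem_head.
have yD : y \in D by rewrite mem_D -lx mem_last.
have ys : y \in s by have := yD; rewrite mem_D inE eq_sym (negPf xy).
have dich a : a \in D -> a != y -> f x (next (x :: s) a) || f y a.
  have [_] := hpath_degin f_sym f_irr (ltnW D4) nham ps; apply.
  by rewrite sum_eq.
case: (prefix_or_switch (f x) s) => [[s1 [R [E s1x Rx]]]|[s1 [u [b [s2 [E nxu xb]]]]]].
  have yR : y \in R.
    by have := ys; rewrite E mem_cat => /orP[/(allP s1x)|//]; rewrite (negPf nxy).
  (* The initial segment is nonempty because x is adjacent to the next vertex of the path. Its last
     vertex w is the cut vertex, with x and q on one side and R on the other. *)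
  case/lastP: s1 => [|q w] in E s1x.
    by case: R E Rx yR => [|z R] //= E /andP[/negP nxz]; move: xs; rewrite E /= => /andP[].
  have uR : uniq (x :: q ++ w :: R) by rewrite -cat_rcons -E.
  left; exists w, [set z in x :: q], [set z in R]; split.
  - by rewrite mem_D E in_cons mem_cat mem_rcons mem_head orbT.
  - have wN : w \notin (x :: q) ++ R.
      have : uniq (w :: (x :: q) ++ R).
        rewrite -(perm_uniq (s1 := x :: q ++ w :: R)) //.
        by apply/permP => P; rewrite /= !count_cat /=; count_lia.
      by case/andP.
    apply/setP => z; rewrite in_setD1 mem_D E in_setU !(in_cons, inE, mem_cat, mem_rcons).
    have [->|_ /=] := eqVneq z w; last by rewrite orbA.
    by move: wN; rewrite in_cons mem_cat orbA => /negPf.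
  - apply/setP => z; rewrite in_setI [z \in [set _ in x :: q]]inE [z \in [set _ in R]]inE [RHS]inE.
    apply/negP => /andP[zq zR].
    move: uR; rewrite -cat_cons cat_uniq => /and3P[_ /hasPn/(_ z)].
    by rewrite inE zR orbT => /(_ isT)/negP.
  - by apply/andP; split; apply/set0Pn; [exists x|exists y]; rewrite inE // mem_head.
  move=> l r; rewrite [l \in _]inE [r \in _]inE => lq rR; apply/negP => lr.
  (* m follows l on the path; it still lies in the initial segment, hence is adjacent to x. *)
  have [t1 [m [t2 [E1 l1 l2]]]] : exists t1 m t2,
      [/\ rcons q w = t1 ++ m :: t2, last x t1 = l & last m t2 = w].
    case/splitPl: lq => p1 p2 l1; case E2 : (rcons p2 w) => [|m t2]; first by case: (p2) E2.
    exists p1, m, t2; split=> //; first by rewrite rcons_cat E2.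
    by rewrite -[LHS]/(last m (m :: t2)) -E2 last_rcons.
  have xm : f x m by move: s1x; rewrite E1 all_cat /= => /and3P[].
  case/splitPr: rR => R1 R2 in E Rx yR uR *.
  (* k, the predecessor of r, is adjacent to y because x is not adjacent to r. *)
  have yk : f y (last w R1).
    have E3 : x :: s = (x :: q ++ belast w R1) ++ last w R1 :: r :: R2.
      by rewrite E cat_rcons /= -catA -[belast _ _ ++ _]cat_rcons -lastI.
    have := dich (last w R1); rewrite E3 next_cat -?E3 //=.
    have -> : f x r = false by move: Rx; rewrite all_cat /= => /and3P[_ /negPf].
    apply; first by rewrite mem_D E3 mem_cat mem_head orbT.
    rewrite -lx; have := us; rewrite E3 cat_uniq /= => /and3P[_ _ /andP[+ _]].
    apply: contra => /eqP->.
    by rewrite -[last x s]/(last x (x :: s)) E3 last_cat /= mem_last.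
  (* The path x .. l m .. k r .. y closes up as x .. l r .. y k .. m x. *)
  case/negP: nham; have D2 := ltnW D4.
  apply: (cycle_ham_on (c := (x :: t1 ++ r :: R2) ++ rev (m :: t2 ++ R1))) _ _ us sD D2.
    move: xs; rewrite E E1 -catA !cat_path /=.
    rewrite l1 => /and5P[xt1 /andP[_ mt2] p1 _ p3].
    apply: cycle_cat_rev => //.
    - by rewrite cat_path xt1 /= l1 lr.
    - by rewrite cat_path mt2.
    - rewrite !last_cat /= l2; move: lx; rewrite E last_cat /= last_cat /= => ->.
      by [].
  apply/permP => P; rewrite E E1 !(count_cat, count_rev) /= !(count_cat, count_rev) /=; count_lia.
right.
(* Cutting u out of x .. a u b .. y leaves the cycle x .. a y .. b x. *)
have uD : u \in D by rewrite mem_D E in_cons mem_cat mem_head !orbT.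
have ya : f y (last x s1).
  have E3 : x :: s = belast x s1 ++ last x s1 :: u :: b :: s2.
    by rewrite E -[RHS]cat_rcons -lastI.
  have := dich (last x s1); rewrite E3 next_cat -?E3 //= (negPf nxu).
  apply; first by rewrite mem_D E3 mem_cat mem_head orbT.
  rewrite -lx; have := us; rewrite E3 cat_uniq => /and3P[_ _ /andP[+ _]].
  apply: contra => /eqP->.
  by rewrite -[last x s]/(last x (x :: s)) E3 last_cat /= inE mem_last orbT.
set c := (x :: s1) ++ rev (b :: s2).
have pc : perm_eq (u :: c) (x :: s).
  by apply/permP => P; rewrite E /c /= !(count_cat, count_rev) /=; count_lia.
have [uNc uc] : u \notin c /\ uniq c.
  by have := us; rewrite -(perm_uniq pc) => /andP[].
have cD : [set z in u :: c] = D.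
  by apply/setP => z; rewrite inE (perm_mem pc) mem_D.
have D_size : #|D| = (size c).+1.
  by rewrite -cD cardsE (card_uniqP _) //= uNc.
have cc : cycle f c.
  move: xs; rewrite E cat_path /= => /and4P[xs1 _ _ bs2].
  apply: cycle_cat_rev => //.
  by move: lx; rewrite E last_cat /= f_sym => ->.
have Si := @successors_independent f D u c f_sym f_irr nham _ cc uc uNc cD.
set N := [set a in D | f u a] in Si *.
set B := next c @: N in Si.
have {}Si : independent f (u |: B) by apply: Si; rewrite -ltnS -D_size.
have BD z : z \in B -> z \in c.
  case/imsetP => a; rewrite inE => /andP[aD ua] ->; rewrite mem_next.
  by move: aD; rewrite -cD inE in_cons => /orP[/eqP ea|//]; rewrite ea f_irr in ua.
have cB : #|B| = #|N| by apply: card_imset; apply: can_inj (prev_next uc).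
have uNB : u \notin B by apply: contra uNc; apply: BD.
have sub_D : u |: B \subset D.
  by apply/subsetP => z /setU1P[->//|/BD zc]; rewrite -cD inE in_cons zc orbT.
exists (u |: B); split=> //; rewrite cardsU1 uNB cB.
have ux : u != x.
  by apply: contraTneq us => <-; rewrite E /= mem_cat mem_head orbT.
have sum_xy := sum_eq x y xD yD xy nxy.
have sum_ux : (#|N| + #|[set z in D | f x z]|).+1 = #|D|.
  by apply: sum_eq; rewrite // f_sym.
have indep a a' : a \in u |: B -> a' \in u |: B -> ~~ f a a'.
  by move=> aS aS'; apply: (forall_inP (forall_inP Si a aS)).
have sum_B a : a \in B -> (#|N| + #|[set z in D | f a z]|).+1 = #|D|.
  move=> aB; have aS : a \in u |: B by rewrite inE aB orbT.
  apply: sum_eq => //; first exact: (subsetP sub_D).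
    by apply: contraNneq uNB => ->.
  by apply: indep; rewrite // setU11.
(* Comparing the tight sums for x, y and for u, x, the degree of u equals that of y, so it is at
   least (#|D| - 1) / 2. *)
have /card_gt1P[b1 [b2 [b1B b2B b12]]] : 1 < #|B|.
  by rewrite cB; nat_lia.
have b1S : b1 \in u |: B by rewrite inE b1B orbT.
have b2S : b2 \in u |: B by rewrite inE b2B orbT.
(* The three tight sums among u, b1 and b2 make their degrees equal, so #|N| is (#|D| - 1) / 2. *)
have := sum_eq b1 b2 (subsetP sub_D _ b1S) (subsetP sub_D _ b2S) b12 (indep _ _ b1S b2S).
move: (sum_B b1 b1B) (sum_B b2 b2B) => /=; nat_lia.
Qed.

(* Adding edges while the graph stays non-Hamiltonian only strengthens the
   hypotheses, and both conclusions pass to subgraphs. *)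
Theorem nonham_structure f D :
    symmetric f -> irreflexive f -> 3 < #|D| -> ~~ ham_on f D ->
    {in D &, forall a b, a != b -> ~~ f a b ->
       #|D| <= (#|[set z in D | f a z]| + #|[set z in D | f b z]|).+1} ->
  separated_on f D \/ half_independent_on f D.
Proof.
move: {2}_.+1 (ltnSn #|[set p : T * T | ~~ f p.1 p.2]|) => k.
elim: k f => // k IH f; rewrite ltnS => fk f_sym f_irr D4 nham ore.
case: (boolP [exists p : T * T, [&& p.1 \in D, p.2 \in D, p.1 != p.2,
     ~~ f p.1 p.2 & ~~ ham_on (add_edge f p.1 p.2) D]]) => [|nomore].
  case/existsP => -[x y] /= /and5P[xD yD xy nfxy nham'].
  set g := add_edge f x y in nham'.
  have fg a b : f a b -> g a b by rewrite /g /add_edge => ->.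
  have fgn a : #|[set z in D | f a z]| <= #|[set z in D | g a z]|.
    by apply/subset_leq_card/subsetP => z; rewrite !inE => /andP[-> /fg->].
  have gi : irreflexive g.
    move=> a; rewrite /g /add_edge f_irr /=.
    by apply/norP; split; apply/negP => /andP[/eqP-> /eqP e]; rewrite e eqxx in xy.
  have [||||||[w [L [R [wD DE LR LR0 nLR]]]]|[S [SD Si Sc]]] := IH g => //.
  - apply: leq_trans fk; apply: proper_card; apply/properP; split.
      by apply/subsetP => -[a b]; rewrite !inE /=; apply: contra => /fg.
    by exists (x, y); rewrite !inE //= /g /add_edge !eqxx orbT.
  - exact: add_edge_sym.
  - move=> a b aD bD ab ngab.
    apply: leq_trans (ore a b aD bD ab _) _; first by apply: contra ngab => /fg.
    by rewrite ltnS leq_add.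
  - left; exists w, L, R; split=> // l r lL rR; apply: contra (nLR l r lL rR); exact: fg.
  - right; exists S; split=> //; apply/forall_inP => a aS; apply/forall_inP => b bS.
    by apply: contra (forall_inP (forall_inP Si a aS) b bS) => /fg.
(* The graph is now maximal: adding any missing edge gives a spanning cycle of D. The resulting path
   bounds the degree sum from above, so it is tight. *)
have path_of a b : a \in D -> b \in D -> a != b -> ~~ f a b -> exists s, hpath f D a b s.
  move=> aD bD ab nab; apply: ham_on_add_edge nham => //.
  by move/existsPn/(_ (a, b)): nomore; rewrite /= aD bD ab nab /= negbK.
have sum_eq : {in D &, forall a b, a != b -> ~~ f a b ->
   (#|[set z in D | f a z]| + #|[set z in D | f b z]|).+1 = #|D|}.
  move=> a b aD bD ab nab; apply/eqP; rewrite eqn_leq ore // andbT.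
  have [s ps] := path_of a b aD bD ab nab.
  by have [] := hpath_degin f_sym f_irr (ltnW D4) nham ps.
case: (boolP [exists p : T * T, [&& p.1 \in D, p.2 \in D, p.1 != p.2 & ~~ f p.1 p.2]]).
  case/existsP => -[x y] /= /and4P[xD yD xy nxy].
  wlog le : x y xD yD xy nxy / #|[set z in D | f x z]| <= #|[set z in D | f y z]|.
    case: (leqP #|[set z in D | f x z]| #|[set z in D | f y z]|) => [le H|/ltnW le H].
      exact: (H x y).
    by apply: (H y x) => //; rewrite 1?eq_sym // f_sym.
  have [s ps] := path_of x y xD yD xy nxy.
  exact: hpath_structure ps.
move/existsPn => full; case/negP: nham; apply: complete_ham_on => [|a b aD bD ab].
  exact: ltnW.
by move: (full (a, b)); rewrite /= aD bD ab /= negbK.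
Qed.

End Spanning.

(** * Cycles and degrees across a cut vertex *)

Section Sides.

Variables (T : finType) (f : rel T) (A B : {set T}).
Hypothesis nAB : {in A & B, forall a b, ~~ f a b}.

Lemma path_side x s :
  path f x s -> x \in A -> {subset s <= A :|: B} -> {subset x :: s <= A}.
Proof.
elim: s x => [|y s IH] x /= => [_ xA _ z|/andP[xy ys] xA sAB z].
  by rewrite inE => /eqP->.
have yA : y \in A.
  have /setUP[//|yB] := sAB y (mem_head _ _).
  by move: xy; rewrite (negPf (nAB xA yB)).
rewrite in_cons => /predU1P[->//|]; apply: IH => // t ts.
by apply: sAB; rewrite in_cons ts orbT.
Qed.

End Sides.

(** Removing w from the cycle, or just opening it if w is not on it, leaves a path inside L and R,
    which cannot change sides. *)
Lemma cycle_separated (T : finType) (f : rel T) (w : T) (L R : {set T}) c l r :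
    symmetric f -> L :&: R = set0 -> {in L & R, forall a b, ~~ f a b} ->
    cycle f c -> uniq c -> {subset c <= w |: (L :|: R)} ->
    w \notin L :|: R -> l \in L -> r \in R -> l \in c -> r \notin c.
Proof.
move=> f_sym LR nLR cc uc cLR wN lL rR lc; apply/negP => rc.
have [x [s [xs wNs ls rs sc]]] : exists x s, [/\ path f x s, w \notin x :: s,
    l \in x :: s, r \in x :: s & {subset x :: s <= c}].
  have [wc|wNc] := boolP (w \in c); last first.
    case: c cc wNc lc rc {uc cLR} => // x s; rewrite /= rcons_path => /andP[xs _].
    by move=> wNc ls rs; exists x, s; split.
  have [i t tE] := rot_to wc.
  have mem_t z : z \in c -> z \in L :|: R -> z \in t.
    rewrite -(mem_rot i) tE in_cons => /predU1P[->|//].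
    by rewrite (negPf wN).
  have lt := mem_t l lc (subsetP (subsetUl L R) _ lL).
  have rt := mem_t r rc (subsetP (subsetUr L R) _ rR).
  rewrite -(rot_uniq i) tE /= in uc; rewrite -(rot_cycle i) tE /= in cc.
  have tc : {subset t <= c} by move=> z zt; rewrite -(mem_rot i) tE in_cons zt orbT.
  case: t tE lt rt uc cc tc {mem_t} => // x s _ lt rt /andP[ws _] + tc.
  by rewrite /= rcons_path => /and3P[_ xs _]; exists x, s; split.
have sLR : {subset x :: s <= L :|: R}.
  move=> z zs; have /setU1P[zw|//] := cLR z (sc z zs).
  by rewrite -zw zs in wNs.
have sLR' : {subset s <= L :|: R} by move=> z zs; apply: sLR; rewrite in_cons zs orbT.
have disj z : z \in L -> z \in R -> False.
  by move=> zL zR; have := in_set0 z; rewrite -LR inE zL zR.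
have /setUP[xL|xR] := sLR x (mem_head _ _).
  exact: (disj r (path_side nLR xs xL sLR' rs)).
have nRL : {in R & L, forall a b, ~~ f a b} by move=> a b aR bL; rewrite f_sym nLR.
apply: (disj l lL); apply: (path_side nRL xs xR) ls => z /sLR'.
by rewrite setUC.
Qed.

(** A vertex of L sees at most w and the rest of L, and likewise for R. This excludes a cut vertex
    when degrees are large. *)
Lemma separated_degin (T : finType) (f : rel T) (D : {set T}) :
    irreflexive f -> symmetric f -> separated_on f D ->
  exists a b, [/\ a \in D, b \in D, a != b, ~~ f a b &
    #|[set z in D | f a z]| + #|[set z in D | f b z]| < #|D|].
Proof.
move=> f_irr f_sym [w [L [R [wD DE LR /andP[/set0Pn[l lL] /set0Pn[r rR]] nLR]]]].
have side (A B : {set T}) a : D :\ w = A :|: B -> a \in A ->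
    {in A & B, forall a b, ~~ f a b} -> #|[set z in D | f a z]| <= #|A|.
  move=> DAB aA nAB.
  have : [set z in D | f a z] \subset (w |: A) :\ a.
    apply/subsetP => z; rewrite !inE => /andP[zD az].
    rewrite (contraTneq _ az) => [|->]; last by rewrite f_irr.
    have [//|zw /=] := eqVneq z w.
    have : z \in D :\ w by rewrite !inE zw zD.
    by rewrite DAB inE => /orP[//|/(nAB _ _ aA)]; rewrite az.
  move/subset_leq_card/leq_trans; apply.
  have aU : a \in w |: A by rewrite inE aA orbT.
  by have := cardsD1 a (w |: A); rewrite aU cardsU1; case: (w \in A) => /=; nat_lia.
have nRL : {in R & L, forall a b, ~~ f a b} by move=> a b aR bL; rewrite f_sym nLR.
have sub_D z : z \in L :|: R -> z \in D by rewrite -DE => /setD1P[].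
exists l, r; split.
- by apply: sub_D; rewrite inE lL.
- by apply: sub_D; rewrite inE rR orbT.
- by apply/eqP => lr; have := in_set0 l; rewrite -LR inE lL lr rR.
- exact: nLR.
- have dl := side L R l DE lL nLR.
  have dr := side R L r _ rR nRL; rewrite DE setUC in dr; have {}dr := dr erefl.
  have cD : #|D| = (#|L| + #|R|).+1.
    by rewrite (cardsD1 w) wD DE cardsU LR cards0 subn0.
  by rewrite cD ltnS leq_add.
Qed.

(** * The two structures of an OTG with a vertex whose deletion leaves no Hamiltonian cycle *)

Section OreGraphs.

Variables (T : finType) (e : rel T).
Hypotheses (e_sym : symmetric e) (e_irr : irreflexive e).
Hypotheses (n_ge5 : 5 <= #|T|) (e_OTG : OTG e).
Implicit Types (D L R S X : {set T}) (x v w : T).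

(** Applied to the complement of a vertex outside X, this shows that deleting the vertex leaves a
    non-Hamiltonian graph. *)
Lemma H_force_ham_on X D : H_force e X -> ham_on e D -> X \subset D -> D = setT.
Proof.
move=> /H_forceP[_ HX] /ham_onP[c /andP[cc /eqP cD]] XD.
have : X_cycle e X c.
  by rewrite /X_cycle cc; apply/subsetP => z /(subsetP XD); rewrite -cD inE.
move/HX => /andP[_ /forallP all_c]; apply/setP => z.
by rewrite -cD !inE all_c.
Qed.

(** Two disjoint cliques L and R, both completely joined to the hubs v and w; whether v and w are
    adjacent is left open. *)
Definition two_cliques v w L R :=
  [/\ v != w, ~: [set v; w] = L :|: R, L :&: R = set0, (L != set0) && (R != set0) &
    {in L & R, forall l r,
      [/\ [set z | e l z] = (v |: (w |: L)) :\ l,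
          [set z | e r z] = (v |: (w |: R)) :\ r & deg e l + deg e r = #|T|]}].

Lemma two_cliques_swap v w L R : two_cliques v w L R -> two_cliques v w R L.
Proof.
case=> vw E LR /andP[L0 R0] H; split; rewrite ?R0 //; first by rewrite [RHS]setUC.
  by rewrite setIC.
by move=> r l rR lL; have [nl nr d] := H l r lL rR; split; rewrite // addnC.
Qed.

Lemma two_cliques_hubC v w L R : two_cliques v w L R -> two_cliques w v L R.
Proof.
case=> vw E LR LR0 H; split; rewrite 1?[w == v]eq_sym // 1?[[set w; v]]setUC //.
by move=> l r lL rR; have [nl nr d] := H l r lL rR; split; rewrite // setUCA.
Qed.

Lemma two_cliques_hub v w L R z :
  two_cliques v w L R -> z \notin [set v; w] -> e v z.
Proof.
case=> vw E LR /andP[/set0Pn[l lL] /set0Pn[r rR]] H; rewrite -in_setC => zLR.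
have zv : z != v by move: zLR; rewrite !inE negb_or => /andP[].
suff : v \in [set t | e z t] by rewrite inE e_sym.
move: zLR; rewrite E => /setUP[zL|zR].
  by have [-> _ _] := H z r zL rR; rewrite !inE eqxx eq_sym zv.
by have [_ -> _] := H l z lL zR; rewrite !inE eqxx eq_sym zv.
Qed.

Lemma two_cliques_deg v w L R : two_cliques v w L R -> #|T| <= (deg e v).+2.
Proof.
move=> tc; have [vw _ _ _ _] := tc.
rewrite -(cardsC [set v; w]) cards2 vw /= add2n !ltnS; apply/subset_leq_card/subsetP => z.
by rewrite in_setC inE; apply: two_cliques_hub tc.
Qed.

(** Vertices l and r have degrees at most #|L| + 1 and #|R| + 1, which sum to n. The OTG condition
    turns both bounds, and the inclusions behind them, into equalities. *)
Lemma separated_two_cliques v :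
  separated_on e (~: [set v]) -> exists w L R, two_cliques v w L R.
Proof.
case=> w [L [R [wv E LR LR0 nLR]]]; exists w, L, R.
have vw : v != w by move: wv; rewrite !inE eq_sym.
have E' : ~: [set v; w] = L :|: R.
  by rewrite -E; apply/setP => z; rewrite !inE negb_or andbC.
have cT : #|T| = (#|L| + #|R|).+2.
  by rewrite -(cardsC [set v; w]) cards2 vw E' cardsU LR cards0 subn0.
split=> // l r lL rR.
have side (A B : {set T}) a : ~: [set v; w] = A :|: B -> a \in A ->
    {in A & B, forall a b, ~~ e a b} ->
    [set z | e a z] \subset (v |: (w |: A)) :\ a /\ #|(v |: (w |: A)) :\ a| <= #|A|.+1.
  move=> EAB aA nAB; split.
    apply/subsetP => z; rewrite !inE => az.
    rewrite (contraTneq _ az) => [|->]; last by rewrite e_irr.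
    have [//|zv /=] := eqVneq z v; have [//|zw /=] := eqVneq z w.
    have : z \in ~: [set v; w] by rewrite !inE negb_or zv zw.
    by rewrite EAB inE => /orP[//|/(nAB _ _ aA)]; rewrite az.
  have aU : a \in v |: (w |: A) by rewrite !inE aA !orbT.
  have := cardsD1 a (v |: (w |: A)); rewrite aU !cardsU1.
  by case: (v \in _); case: (w \in A) => /=; nat_lia.
have nRL : {in R & L, forall a b, ~~ e a b} by move=> a b aR bL; rewrite e_sym nLR.
have [sl cl] := side L R l E' lL nLR.
have [|sr cr] := side R L r _ rR nRL; first by rewrite E' setUC.
have lr : l != r by apply/eqP => lr; have := in_set0 l; rewrite -LR inE lL lr rR.
have := e_OTG lr (nLR l r lL rR); rewrite cT /deg => d.
have dl := subset_leq_card sl; have dr := subset_leq_card sr.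
split.
- by apply/eqP; rewrite eqEcard sl /=; nat_lia.
- by apply/eqP; rewrite eqEcard sr /=; nat_lia.
- by nat_lia.
Qed.

Lemma nonham_vertex x : ~~ ham_on e (~: [set x]) ->
  (exists w L R, two_cliques x w L R) \/
  (exists S, [/\ x \notin S, independent e S & #|S|.*2 = #|T|]).
Proof.
move=> nham; have cD : #|~: [set x]| = #|T|.-1 by rewrite cardsC1.
have [||sep|[S [SD Si cS]]] := nonham_structure e_sym e_irr _ nham.
- by rewrite cD; nat_lia.
- move=> a b aD bD ab nab; rewrite cD.
  (* Each degree drops by at most one, so the sum stays at least n - 2. *)
  have degD c : deg e c <= #|[set z in ~: [set x] | e c z]|.+1.
    apply: leq_trans (_ : #|x |: [set z in ~: [set x] | e c z]| <= _).
      by apply/subset_leq_card/subsetP => z; rewrite !inE => ->; case: eqP.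
    by rewrite cardsU1; case: (x \in _) => /=; nat_lia.
  move: (e_OTG ab nab) (degD a) (degD b); nat_lia.
- by left; apply: separated_two_cliques.
right; exists S; split=> //; last by rewrite cS cD; nat_lia.
by apply/negP => /(subsetP SD); rewrite !inE eqxx.
Qed.

(** * Independent sets of size n / 2 *)

Section Half.

Variable S : {set T}.
Hypotheses (S_indep : independent e S) (S_half : #|S|.*2 = #|T|).

Lemma card_half_compl : #|~: S| = #|S|.
Proof. by have := cardsC S; nat_lia. Qed.

(** Two vertices of S have at most n / 2 neighbours each, all outside S, while their degrees sum to
    at least n. *)
Lemma half_nbr s : s \in S -> [set z | e s z] = ~: S.
Proof.
move=> sS.
have sub a : a \in S -> [set z | e a z] \subset ~: S.
  move=> aS; apply/subsetP => z; rewrite !inE => az.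
  by apply: contraL az => zS; apply: (forall_inP (forall_inP S_indep a aS)).
have [t /andP[ts tS]] : exists t, (t != s) && (t \in S).
  have /card_gt0P[t] : 0 < #|S :\ s|.
    by have := cardsD1 s S; rewrite sS /=; nat_lia.
  by rewrite !inE; exists t.
have := e_OTG ts (forall_inP (forall_inP S_indep t tS) s sS).
have := subset_leq_card (sub t tS); rewrite card_half_compl /deg => dt d.
by apply/eqP; rewrite eqEcard sub // card_half_compl /=; nat_lia.
Qed.

(** If R meets S, then R lies inside S, since a vertex of S sees the whole complement; otherwise R
    lies in the complement, which has the same size. *)
Lemma half_largest R : independent e R -> #|R| <= #|S|.
Proof.
move=> R_indep; have [RS|] := boolP [disjoint R & S].
  rewrite -card_half_compl; apply: subset_leq_card.
  by rewrite -disjoints_subset.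
case/pred0Pn => s /andP[/= sR sS]; apply: subset_leq_card; apply/subsetP => a aR.
apply: contraLR (forall_inP (forall_inP R_indep s sR) a aR) => aS.
have : a \in [set z | e s z] by rewrite half_nbr // inE.
by rewrite inE negbK.
Qed.

(** On a cycle through S, the successors of S lie outside S, and together with S they number n. *)
Lemma half_H_force : H_force e S.
Proof.
apply/H_forceP; split; first by rewrite -card_gt0; nat_lia.
move=> c /andP[cyc /subsetP Sc]; rewrite /hamiltonian_cycle cyc /=.
case/and3P: cyc => _ cc uc.
have sub : S :|: next c @: S \subset c.
  apply/subsetP => z /setUP[/Sc//|/imsetP[a aS ->]].
  by rewrite mem_next Sc.
have disj : S :&: next c @: S = set0.
  apply/setP => z; rewrite in_setI in_set0; apply/negP => /andP[zS /imsetP[a aS za]].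
  have := forall_inP (forall_inP S_indep a aS) z zS.
  by rewrite za next_cycle ?Sc.
have := subset_leq_card sub; rewrite cardsU disj cards0 subn0.
rewrite card_imset; last exact: can_inj (prev_next uc).
rewrite addnn S_half => Tc; have /eqP cT : #|c| == #|T| by rewrite eqn_leq Tc max_card.
by apply/forallP => v; have /(subset_cardP cT)-> : c \subset T by apply/subsetP.
Qed.

End Half.

(** * H-force sets in the two structures *)

Lemma two_cliques_H_force v w L R :
  two_cliques v w L R -> H_force e (~: [set v; w]).
Proof.
move=> tc; have [vw E LR /andP[/set0Pn[l lL] /set0Pn[r rR]] H] := tc.
have nLR : {in L & R, forall a b, ~~ e a b}.
  move=> a b aL bR; have [Ea _ _] := H a b aL bR.
  apply: contraFN (in_set0 b) => ab; have : b \in [set z | e a z] by rewrite inE.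
  have : b \in ~: [set v; w] by rewrite E inE bR orbT.
  rewrite Ea -LR !inE negb_or => /andP[/negPf-> /negPf->] /= /andP[_ ->].
  by rewrite bR.
have lX : l \in ~: [set v; w] by rewrite E inE lL.
have rX : r \in ~: [set v; w] by rewrite E inE rR orbT.
apply/H_forceP; split; first by apply/set0Pn; exists l.
move=> c /andP[cyc /subsetP Xc]; rewrite /hamiltonian_cycle cyc /=.
case/and3P: cyc => _ cc uc.
(* If the cycle missed one hub, the other hub would be a cut vertex for it, yet it visits both
   cliques. *)
have avoid a b : [set v; w] = [set a; b] -> a \in c.
  move=> vwE; apply: contraT => ac.
  suff : r \notin c by rewrite Xc.
  apply: (cycle_separated (w := b) e_sym LR nLR cc uc) lL rR (Xc l lX).
    move=> z zc; rewrite -E vwE !inE negb_or; case: eqP => //= _.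
    by rewrite andbT; apply: contraNneq ac => <-.
  by rewrite -E vwE !inE eqxx orbT.
apply/forallP => z; have [->|zv] := eqVneq z v; first exact: avoid.
have [->|zw] := eqVneq z w; first by apply: (avoid _ v); rewrite setUC.
by apply: Xc; rewrite !inE negb_or zv zw.
Qed.

(** Were G - x not Hamiltonian, [nonham_vertex] would apply at x. Either r, not adjacent to x, is
    the second hub beside x, and their degree sum is at least 2n - 4 rather than n; or x and r lie
    outside an independent set of size n / 2 contained in their common neighbours v and w. Both fail
    for n at least 5. *)
Lemma two_cliques_ham v w L R x :
  two_cliques v w L R -> x \notin [set v; w] -> ham_on e (~: [set x]).
Proof.
move=> + xvw.
wlog xL : L R / x \in L => [H|] tc.
  have [_ E _ _ _] := tc; move: (xvw); rewrite -in_setC E => /setUP[xL|xR].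
    exact: (H L R).
  by apply: (H R L); last exact: two_cliques_swap.
apply: contraT => nham.
have [vw E LR /andP[_ /set0Pn[r rR]] H] := tc.
have [nx nr dxr] := H x r xL rR.
have disj z : z \in L -> z \in R -> False.
  by move=> zL zR; have := in_set0 z; rewrite -LR inE zL zR.
have common z : e x z -> e r z -> z \in [set v; w].
  move=> xz rz; have : z \in [set t | e x t] by rewrite inE.
  have : z \in [set t | e r t] by rewrite inE.
  rewrite nx nr !inE; case: (z == v) => //=; case: (z == w) => //=.
  by move=> /andP[_ zR] /andP[_ zL]; case: (disj z).
have xr : ~~ e x r.
  apply/negP => xr; have : r \in [set t | e x t] by rewrite inE.
  have : r \in ~: [set v; w] by rewrite E inE rR orbT.
  rewrite nx !inE negb_or => /andP[/negPf-> /negPf->] /= /andP[_ rL].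
  exact: disj rL rR.
have rx : r != x by apply/eqP => rx; apply: (disj r) => //; rewrite rx.
have [[w' [L' [R' tc']]]|[S [xS Si cS]]] := nonham_vertex nham.
  have rw' : r = w'.
    apply: contraNeq xr => rw'; apply: two_cliques_hub tc' _.
    by rewrite !inE negb_or rx rw'.
  have := two_cliques_deg tc'; have := two_cliques_deg (two_cliques_hubC tc').
  by rewrite -rw'; nat_lia.
have rS : r \notin S.
  apply: contra xr => rS; rewrite e_sym.
  have : x \in [set z | e r z] by rewrite (half_nbr Si cS rS) inE.
  by rewrite inE.
have : S \subset [set v; w].
  apply/subsetP => s sS; have ns := half_nbr Si cS sS.
  have : x \in [set z | e s z] by rewrite ns inE.
  have : r \in [set z | e s z] by rewrite ns inE.
  by rewrite !inE => sr sx; have := common s; rewrite !inE; apply; rewrite e_sym.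
by move/subset_leq_card; rewrite cards2 vw; nat_lia.
Qed.

Lemma half_min_H_force S X :
    independent e S -> #|S|.*2 = #|T| -> H_force e X -> #|X| <= #|S| ->
  independent e X /\ #|X|.*2 = #|T|.
Proof.
move=> Si cS HX XS.
have sub S' : #|S'| = #|S| -> S' \subset X -> S' = X.
  by move=> cS' sX; apply/eqP; rewrite eqEcard sX cS'.
have [/sub<-//|/subsetPn[s sS sX]] := boolP (S \subset X).
have nham : ~~ ham_on e (~: [set s]).
  apply/negP => /(H_force_ham_on HX) H.
  have : s \in ~: [set s] by rewrite H ?inE // subsetC sub1set inE.
  by rewrite !inE eqxx.
have [[w' [L' [R' /two_cliques_deg]]]|[S2 [sS2 S2i cS2]]] := nonham_vertex nham.
  by rewrite /deg (half_nbr Si cS sS) (card_half_compl cS); nat_lia.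
(* Each vertex of S2 is adjacent to s, which lies outside S2, so none of them is in S. *)
have S2E : S2 = ~: S.
  apply/eqP; rewrite eqEcard (card_half_compl cS).
  apply/andP; split; last by nat_lia.
  apply/subsetP => z zS2; rewrite inE; apply/negP => zS.
  have : s \in [set t | e z t] by rewrite (half_nbr S2i cS2 zS2) inE.
  by rewrite inE (negPf (forall_inP (forall_inP Si z zS) s sS)).
have [/sub<-//|/subsetPn[a aS2 aX]] := boolP (S2 \subset X); first by nat_lia.
have sa : s != a by apply: contraNneq sS2 => ->.
have cD : #|~: [set s; a]| = #|T| - 2.
  by have := cardsC [set s; a]; rewrite cards2 sa /=; nat_lia.
have degD b : #|S| <= #|[set z in ~: [set s; a] | e b z]|.+1.
  have [t sub_t] : exists t, [set z | e b z] \subset t |: [set z in ~: [set s; a] | e b z].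
    have [bS|bS] := boolP (b \in S).
      exists a; apply/subsetP => z; rewrite !inE => bz; rewrite bz andbT negb_or.
      case: eqP => //= _; rewrite andbT; apply: contraTneq bz => ->.
      exact: (forall_inP (forall_inP Si b bS)).
    exists s; apply/subsetP => z; rewrite !inE => bz; rewrite bz andbT negb_or.
    case: eqP => //= _; apply: contraTneq bz => ->.
    by apply: (forall_inP (forall_inP S2i b _)); rewrite // S2E inE.
  have degb : #|[set z | e b z]| = #|S|.
    have [bS|bS] := boolP (b \in S); first by rewrite (half_nbr Si cS bS) (card_half_compl cS).
    by rewrite (half_nbr S2i cS2) ?(card_half_compl cS2); [nat_lia|rewrite S2E inE].
  rewrite -degb; apply: leq_trans (subset_leq_card sub_t) _.
  by rewrite cardsU1; case: (t \in _) => /=; nat_lia.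
(* Here G is complete bipartite with parts S and S2; a cycle through all vertices
   but s and a exists, as [~: [set s; a]] fits neither case of the structure
   theorem. *)
suff hamD : ham_on e (~: [set s; a]).
  have : s \in ~: [set s; a].
    rewrite (H_force_ham_on HX hamD) ?inE //.
    by apply/subsetP => z zX; rewrite !inE negb_or; apply/andP; split;
      apply: contraTneq zX => ->.
  by rewrite !inE eqxx.
apply: contraT => nhamD.
(* Since n is even, it is at least 6 and the set has at least 4 vertices. Its inner degrees, at
   least n / 2 - 1, exclude a cut vertex; its even size n - 2 excludes the independent set. *)
have [||sep|[S3 [_ _ cS3]]] := nonham_structure e_sym e_irr _ nhamD.
- by rewrite cD; nat_lia.
- by move=> b d _ _ _ _; move: (degD b) (degD d); rewrite cD; nat_lia.
- have [b [d [_ _ _ _]]] := separated_degin e_irr e_sym sep.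
  by move: (degD b) (degD d); rewrite cD; nat_lia.
- by rewrite cD in cS3; nat_lia.
Qed.

(** * The weak closure of the two structures *)

Lemma weak_joins_half f : weak_joins e f ->
  [/\ symmetric f, irreflexive f, subrel e f &
    forall S, independent e S -> #|S|.*2 = #|T| -> independent f S].
Proof.
elim=> [|g u v _ [g_sym g_irr eg gS] /and3P[uv nuv d]]; first by split.
split.
- exact: add_edge_sym.
- move=> a; rewrite /add_edge g_irr /=; apply/norP.
  by split; apply/negP => /andP[/eqP-> /eqP E]; rewrite E eqxx in uv.
- by move=> a b /eg ab; rewrite /add_edge ab.
move=> S Si cS; have {}gS := gS S Si cS.
(* While S is independent, two of its vertices have degree sum at most n, so they are never
   joined. *)
have gdeg s : s \in S -> deg g s <= #|S|.
  move=> sS; rewrite -(card_half_compl cS); apply/subset_leq_card/subsetP => z.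
  rewrite !inE => sz; apply: contraL sz => zS.
  exact: (forall_inP (forall_inP gS s sS)).
have uvS : ~~ ((u \in S) && (v \in S)).
  by apply/negP => /andP[/gdeg du /gdeg dv]; nat_lia.
apply/forall_inP => s sS; apply/forall_inP => t tS.
rewrite /add_edge (negPf (forall_inP (forall_inP gS s sS) t tS)) /=.
by apply: contra uvS => /orP[] /andP[/eqP<- /eqP<-]; rewrite sS tS.
Qed.

Lemma two_cliques_closure v w L R c :
  two_cliques v w L R -> weak_closure e c -> deg c v = #|T| - 1.
Proof.
move=> tc [/weak_joins_half[c_sym c_irr ec _] closed].
have [vw _ _ _ _] := tc.
have dc z : deg e z <= deg c z.
  by apply/subset_leq_card/subsetP => t; rewrite !inE; apply: ec.
(* The hubs have degree sum at least 2n - 4, which is at least n + 1 because n is at least 5. *)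
have cvw : c v w.
  have := closed v w; rewrite /joinable vw /=.
  have := two_cliques_deg tc; have := two_cliques_deg (two_cliques_hubC tc).
  move=> dw dv; have -> : #|T| < deg c v + deg c w by move: (dc v) (dc w); nat_lia.
  by rewrite andbT negbK.
rewrite subn1 -(cardsC1 v); apply: eq_card => z; rewrite !inE.
have [->|zv] := eqVneq z v; first by rewrite c_irr.
have [->|zw] := eqVneq z w; first by rewrite cvw.
by apply: ec; apply: two_cliques_hub tc _; rewrite !inE negb_or zv zw.
Qed.

Lemma min_H_force_cases X : min_H_force e X ->
  [\/ X = setT,
      exists v w L R, two_cliques v w L R /\ X = ~: [set v; w]
    | independent e X /\ #|X|.*2 = #|T|].
Proof.
case/andP => HX /eqP cX.
have T0 : 0 < #|T| by nat_lia.
have out x : x \notin X -> ~~ ham_on e (~: [set x]).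
  move=> xX; apply/negP => /(H_force_ham_on HX) H.
  have : x \in ~: [set x] by rewrite H ?inE // subsetC sub1set inE.
  by rewrite !inE eqxx.
have [|/subsetPn[x _ xX]] := boolP (setT \subset X).
  by rewrite subTset => /eqP->; apply: Or31.
have [[w [L [R tc]]]|[S [_ Si cS]]] := nonham_vertex (out x xX).
  (* X contains every vertex except possibly the hubs, since deleting a non-hub leaves a Hamiltonian
     graph. The non-hubs already form an H-force set, so minimality gives equality. *)
  apply: Or32; exists x, w, L, R; split=> //; apply/esym/eqP.
  rewrite eqEcard cX h_leq ?(two_cliques_H_force tc) // andbT.
  apply/subsetP => z; rewrite inE => zxw; apply: contraT => /out.
  by rewrite (two_cliques_ham tc zxw).
apply: Or33; apply: (half_min_H_force Si cS HX).
by rewrite cX h_leq // half_H_force.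
Qed.

End OreGraphs.

Theorem theorem2p2 (T : finType) (e : rel T)
  (e_sym : symmetric e) (e_irr : irreflexive e)
  (n_ge5 : 5 <= #|T|) (e_OTG : OTG e)
  (X : {set T}) (X_min : min_H_force e X)
  (Cw : rel T) (Cw_closure : weak_closure e Cw) :
  [\/ h e = #|T| - 2, (h e).*2 = #|T| | h e = #|T|] /\
  [/\ h e = #|T| - 2 ->
        exists x y : T,
          [/\ x != y, X = [set: T] :\: [set x; y],
              deg Cw x = #|T| - 1 & deg Cw y = #|T| - 1],
      (h e).*2 = #|T| ->
        exists S : {set T}, largest_independent Cw S /\ X = S
    & h e = #|T| -> X = [set: T]].
Proof.
have /andP[_ /eqP <-] := X_min.
have [->|[v [w [L [R [tc XE]]]]]|[Xi cX]] :=
  min_H_force_cases e_sym e_irr n_ge5 e_OTG X_min.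
(* The values n - 2, n / 2 and n are distinct for n at least 5, so in each case only one premise of
   the second part can hold. *)
- by rewrite cardsT; split; [apply: Or33|split=> //; nat_lia].
- have [vw _ _ _ _] := tc.
  have cX : #|X| = #|T| - 2.
    by rewrite XE; have := cardsC [set v; w]; rewrite cards2 vw /=; nat_lia.
  split; first exact: Or31.
  split=> [_||]; [|nat_lia|nat_lia].
  exists v, w; split; rewrite // ?XE ?setTD //.
    exact: two_cliques_closure tc Cw_closure.
  exact: two_cliques_closure (two_cliques_hubC tc) Cw_closure.
split; first exact: Or32.
split=> [|_|]; [nat_lia| |nat_lia].
exists X; split=> //.
have [_ _ eC half] := weak_joins_half e_sym e_irr n_ge5 Cw_closure.1.
split=> [|S Si]; first exact: half.
apply: (half_largest _ _ Xi cX) => //.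
apply/forall_inP => a aS; apply/forall_inP => b bS.
by apply: contra (forall_inP (forall_inP Si a aS) b bS); apply: eC.
Qed.
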